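(* Let $f:\mathbb{R}^d\to\mathbb{R}$ be a differentiable function and let $\alpha\ge 0$. Then $f$ is concavifiable with concavifier $\alpha$ if and only if $f$ satisfies the upper quadratic approximation with constant $\alpha$, i.e. if and only if for all $\bm{x},\bm{y}\in\mathbb{R}^d$ $$f(\bm{y})\le f(\bm{x})+\nabla f(\bm{x})^T(\bm{y}-\bm{x})+\frac{\alpha}{2}\|\bm{y}-\bm{x}\|^2 .$$
   Context: $\|\cdot\|$ is the Euclidean norm on $\mathbb{R}^d$. A function $f:\mathbb{R}^d\to\mathbb{R}$ is concavifiable with concavifier $\alpha$ if the function $g(\bm{x})=\frac{\alpha}{2}\|\bm{x}\|^2-f(\bm{x})$ is convex on $\mathbb{R}^d$. *)

(* Defs.v *)
From mathcomp Require Import all_boot all_order all_algebra.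
From mathcomp Require Import all_classical all_reals all_analysis.

Set Implicit Arguments.
Unset Strict Implicit.
Unset Printing Implicit Defensive.

Import Order.TTheory GRing.Theory Num.Theory.
Import numFieldNormedType.Exports.

Local Open Scope classical_set_scope.
Local Open Scope ring_scope.

Definition dotprod (R : realType) (d : nat) (u v : 'rV[R]_d) : R :=
  \sum_(i < d) u 0 i * v 0 i.

(* The library norm `|x| on 'rV[R]_d is the sup norm, hence this definition.
   Both norms induce the same topology and the same differentiable functions. *)
Definition enorm (R : realType) (d : nat) (x : 'rV[R]_d) : R :=
  Num.sqrt (\sum_(i < d) x 0 i ^+ 2).

Definition grad (R : realType) (d : nat) (f : 'rV[R]_d -> R) (x : 'rV[R]_d) :
    'rV[R]_d :=
  \row_(i < d) 'D_(delta_mx 0 i) f x.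

Definition concavifiable_with (R : realType) (d : nat) (f : 'rV[R]_d -> R)
    (alpha : R) : Prop :=
  convex_function [set: convex_lmodType 'rV[R]_d]
    (fun x : 'rV[R]_d => alpha / 2 * enorm x ^+ 2 - f x).

Definition upper_quadratic_approx (R : realType) (d : nat)
    (f : 'rV[R]_d -> R) (alpha : R) : Prop :=
  forall x y : 'rV[R]_d,
    f y <= f x + dotprod (grad f x) (y - x) + alpha / 2 * enorm (y - x) ^+ 2.

(* Main.v *)
(* The identity t |x|^2 + (1-t) |y|^2 - |t x + (1-t) y|^2 = t (1-t) |x-y|^2
   turns concavifiability into
     t f(x) + (1-t) f(y) <= f(t x + (1-t) y) + (alpha/2) t (1-t) |x-y|^2.
   Dividing by t and letting t -> 0+ gives the quadratic upper bound.
   Conversely, at z = t x + (1-t) y the upper bounds for f(x) and f(y) average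
   to this inequality, since the gradient terms cancel. *)
Require Import Defs.
From mathcomp Require Import all_boot all_order all_algebra.
From mathcomp Require Import all_classical all_reals all_analysis.
From mathcomp Require Import ring lra.

Import Order.TTheory GRing.Theory Num.Theory.
Import numFieldNormedType.Exports.

Local Open Scope ring_scope.

Lemma dotprodZr (R : realType) (d : nat) (a : R) (u v : 'rV[R]_d) :
  dotprod u (a *: v) = a * dotprod u v.
Proof.
by rewrite /dotprod mulr_sumr; apply: eq_bigr => i _; rewrite mxE mulrCA.
Qed.

Lemma enorm_sqr (R : realType) (d : nat) (x : 'rV[R]_d) :
  enorm x ^+ 2 = \sum_(i < d) x 0 i ^+ 2.
Proof. by rewrite sqr_sqrtr// sumr_ge0// => i _; rewrite sqr_ge0. Qed.

Lemma enormZ_sqr (R : realType) (d : nat) (a : R) (x : 'rV[R]_d) :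
  enorm (a *: x) ^+ 2 = a ^+ 2 * enorm x ^+ 2.
Proof.
by rewrite !enorm_sqr mulr_sumr; apply: eq_bigr => i _; rewrite mxE exprMn.
Qed.

Lemma enorm_conv_sqr (R : realType) (d : nat) (t : R) (x y : 'rV[R]_d) :
  enorm (t *: x + (1 - t) *: y) ^+ 2 =
  t * enorm x ^+ 2 + (1 - t) * enorm y ^+ 2 - t * (1 - t) * enorm (x - y) ^+ 2.
Proof.
rewrite !enorm_sqr !mulr_sumr -sumrN -!big_split/=.
by apply: eq_bigr => i _; rewrite !mxE; ring.
Qed.

(** The differential is linear, so expanding [v] in the standard basis leaves the partial
    derivatives as coefficients. *)
Lemma derive_dotprod_grad (R : realType) (d : nat) (f : 'rV[R]_d -> R)
    (x v : 'rV[R]_d) :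
  differentiable f x -> 'D_v f x = dotprod (grad f x) v.
Proof.
move=> fx; rewrite deriveE// [in LHS](row_sum_delta v) linear_sum/=.
by apply: eq_bigr => i _; rewrite linearZ/= mxE deriveE// mulrC.
Qed.

Lemma concavifiable_withP (R : realType) (d : nat) (f : 'rV[R]_d -> R)
    (alpha : R) :
  concavifiable_with f alpha <->
  forall (t : R) (x y : 'rV[R]_d), 0 <= t <= 1 ->
    t * f x + (1 - t) * f y <=
    f (t *: x + (1 - t) *: y) + alpha / 2 * (t * (1 - t) * enorm (x - y) ^+ 2).
Proof.
split=> [fconv t x y /andP[t0 t1]|fle t x y _ _].
  have := fconv (Itv01 t0 t1) x y (mem_set I) (mem_set I).
  rewrite convRE /conv/= /unstable.onem enorm_conv_sqr; lra.
have /fle : 0 <= t%:num <= 1 by rewrite ge0 le1.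
move=> /(_ x y).
rewrite convRE /conv/= /unstable.onem enorm_conv_sqr; lra.
Qed.

Theorem lemma3p1 (R : realType) (d : nat) (f : 'rV[R]_d -> R) (alpha : R)
    (f_diff : forall x : 'rV[R]_d, differentiable f x) (alpha_ge0 : 0 <= alpha) :
  concavifiable_with f alpha <-> upper_quadratic_approx f alpha.
Proof.
rewrite concavifiable_withP; split=> [fle x y|fub t x y /andP[t0 t1]].
  (* Isolate the directional derivative: it suffices to bound its difference quotients from below
     for small [t > 0]. *)
  rewrite -derive_dotprod_grad// -addrA -lerBlDl -lerBlDr.
  have /cvg_dnbhs_at_right lim_f := @diff_derivable _ _ _ f x (y - x) (f_diff x).
  apply: (cvgr_to_ge lim_f); near=> t.
  have t0 : 0 < t by near: t; exact: nbhs_right_gt.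
  have t1 : t <= 1 by near: t; exact: nbhs_right_le.
  have := fle t y x; rewrite (ltW t0) t1 => /(_ isT) fyx.
  rewrite /= [_ *: _]mulrC ler_pdivlMr//.
  have -> : t *: (y - x) + x = t *: y + (1 - t) *: x.
    by rewrite scalerBr scalerBl scale1r addrA [RHS]addrAC.
  (* Here [0 <= alpha] lets the factor [t * (1 - t)] in [fyx] be relaxed to [t], making the bound on
     the quotient independent of [t]. *)
  have : 0 <= alpha * (t ^+ 2 * enorm (y - x) ^+ 2).
    by rewrite mulr_ge0// mulr_ge0// sqr_ge0.
  lra.
set z := t *: x + (1 - t) *: y.
(* Both displacements from [z] are multiples of [x - y], so the gradient terms are comparable. *)
have xz : x - z = (1 - t) *: (x - y).
  by apply/rowP => i; rewrite !mxE; ring.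
have yz : y - z = (- t) *: (x - y).
  by apply/rowP => i; rewrite !mxE; ring.
have := fub z x; have := fub z y.
rewrite xz yz !dotprodZr !enormZ_sqr sqrrN => fy fx.
have t1' : 0 <= 1 - t by rewrite subr_ge0.
(* The quadratic terms add up by [t * (1 - t)^2 + (1 - t) * t^2 = t * (1 - t)]. *)
have := lerD (ler_wpM2l t0 fx) (ler_wpM2l t1' fy); lra.
Unshelve. all: by end_near.
Qed.
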